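(* Let $p\in\mathbb N$, let $\mathbf f^{[\nu]}\in\mathcal C^{p+1}(\mathbb R^d,\mathbb R^d)$ be Lipschitz continuous for $\nu=1,\dots,N$, and consider the NSARK method with coefficients $a_{ij}^{[\nu]}(\mathbf y^n,\Delta t)$, $b_j^{[\nu]}(\mathbf y^n,\Delta t)$ (see context). Let $d_i$, $g_i^{[\nu]}$ and $u$ be the functions defined recursively in the context. Suppose that for small enough $\Delta t$ there exists a solution $\mathbf y^{(1)},\dots,\mathbf y^{(s)}$ of the stage equations, and that $a_{ij}^{[\nu]}(\mathbf y^n,\Delta t)=\mathcal O(1)$ as $\Delta t\to0$ for all $i,j=1,\dots,s$ and $\nu=1,\dots,N$. Then, for $i=1,\dots,s$ and $\nu=1,\dots,N$, the stages, stage derivatives and output of the NSARK method can be expressed as $$\mathbf y^{(i)}=\mathbf y^n+\sum_{\tau\in NT_{p}}\frac{\Delta t^{|\tau|}}{\sigma(\tau)}\,d_i(\tau,\mathbf y^n,\Delta t)\,\mathcal F(\tau)(\mathbf y^n)+\mathcal O(\Delta t^{p+1}),$$ $$\Delta t\,\mathbf f^{[\nu]}(\mathbf y^{(i)})=\sum_{\tau\in NT_{p}}\frac{\Delta t^{|\tau|}}{\sigma(\tau)}\,g^{[\nu]}_i(\tau,\mathbf y^n,\Delta t)\,\mathcal F(\tau)(\mathbf y^n)+\mathcal O(\Delta t^{p+1}),$$ $$\mathbf y^{n+1}=\mathbf y^n+\sum_{\tau\in NT_{p}}\frac{\Delta t^{|\tau|}}{\sigma(\tau)}\,u(\tau,\mathbf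 y^n,\Delta t)\,\mathcal F(\tau)(\mathbf y^n)+\mathcal O(\Delta t^{p+1}).$$
   Context: Autonomous initial value problem: $\mathbf y'=\mathbf f(\mathbf y)=\sum_{\nu=1}^N\mathbf f^{[\nu]}(\mathbf y)$, $\mathbf y\in\mathbb R^d$. NSARK method (non-standard additive Runge--Kutta method) with $s$ stages, for a fixed $\mathbf y^n\in\mathbb R^d$ and step size $\Delta t>0$: $$\mathbf y^{(i)}=\mathbf y^n+\Delta t\sum_{j=1}^s\sum_{\nu=1}^N a_{ij}^{[\nu]}(\mathbf y^n,\Delta t)\,\mathbf f^{[\nu]}(\mathbf y^{(j)}),\ i=1,\dots,s,\qquad \mathbf y^{n+1}=\mathbf y^n+\Delta t\sum_{j=1}^s\sum_{\nu=1}^N b_{j}^{[\nu]}(\mathbf y^n,\Delta t)\,\mathbf f^{[\nu]}(\mathbf y^{(j)}),$$ where the coefficients are real numbers that may depend on $\mathbf y^n$ and $\Delta t$ (possibly implicitly). Colored trees: $NT$ is the set of all (unordered) rooted trees whose nodes each carry a color in $\{1,\dots,N\}$; $|\tau|$ is the number of nodes of $\tau$ and $NT_q=\{\tau\in NT: |\tau|\le q\}$. The one-node tree of color $\mu$ is $\bullet^{[\mu]}$. A tree with root color $\mu$ and children (connected components after removing the root) $\tau_1,\dots,\tau_l$ is written $[\tau_1,\dots,\tau_l]^{[\mu]}$, or $[\tau_1^{m_1},\dots,\tau_r^{m_r}]^{[\mu]}$ when the distinct children $\tau_1,\dots,\tau_r$ occur with multiplicities $m_1,\dots,m_r$. Symmetry: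 $\sigma(\bullet^{[\mu]})=1$, $\sigma([\tau_1^{m_1},\dots,\tau_r^{m_r}]^{[\mu]})=\prod_{j=1}^r m_j!\,\sigma(\tau_j)^{m_j}$. Elementary differentials: $\mathcal F(\bullet^{[\nu]})(\mathbf y)=\mathbf f^{[\nu]}(\mathbf y)$ and $\mathcal F([\tau_1,\dots,\tau_l]^{[\nu]})(\mathbf y)=\sum_{i_1,\dots,i_l=1}^d\partial_{i_1\cdots i_l}\mathbf f^{[\nu]}(\mathbf y)\,\mathcal F_{i_1}(\tau_1)(\mathbf y)\cdots\mathcal F_{i_l}(\tau_l)(\mathbf y)$. With the Kronecker delta $\delta_{\nu\mu}$, the functions $u,g_i^{[\nu]},d_i$ are defined by $$u(\tau,\mathbf y^n,\Delta t)=\sum_{\nu=1}^N\sum_{i=1}^s b_i^{[\nu]}(\mathbf y^n,\Delta t)\,g_i^{[\nu]}(\tau,\mathbf y^n,\Delta t),\qquad d_i(\tau,\mathbf y^n,\Delta t)=\sum_{\nu=1}^N\sum_{j=1}^s a_{ij}^{[\nu]}(\mathbf y^n,\Delta t)\,g_j^{[\nu]}(\tau,\mathbf y^n,\Delta t),$$ $$g_i^{[\nu]}(\bullet^{[\mu]},\mathbf y^n,\Delta t)=\delta_{\nu\mu},\qquad g_i^{[\nu]}([\tau_1,\dots,\tau_l]^{[\mu]},\mathbf y^n,\Delta t)=\delta_{\nu\mu}\prod_{j=1}^l d_i(\tau_j,\mathbf y^n,\Delta t).$$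
   Formalization: The expansion of y^{n+1} is proved under the additional assumption b_j^{[ν]}(y^n,Δt)=O(1) as Δt→0, without which it fails (e.g. f(y)=y, a=1, b=1/Δt, p=1); the other two expansions are as stated. *)

(* Defs.v *)
From Stdlib Require List.
From HB Require Import structures.
From mathcomp Require Import all_boot all_order all_algebra.
From mathcomp Require Import all_classical all_reals all_analysis.

Set Implicit Arguments.
Unset Strict Implicit.
Unset Printing Implicit Defensive.

Import Order.TTheory GRing.Theory Num.Theory.
Import numFieldNormedType.Exports.

Local Open Scope classical_set_scope.
Local Open Scope ring_scope.

Inductive ptree (N : nat) : Type := PNode of 'I_N & seq (ptree N).

Lemma ptree_ind' (N : nat) (P : ptree N -> Prop) :
  (forall c ts, List.Forall P ts -> P (PNode c ts)) -> forall t, P t.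
Proof.
move=> PN; fix IH 1 => -[c ts]; apply: PN.
by elim: ts => [|t ts IHts]; constructor.
Qed.

Fixpoint ptree_encode (N : nat) (t : ptree N) : GenTree.tree unit :=
  let: PNode c ts := t in GenTree.Node c (map (@ptree_encode N) ts).

Fixpoint ptree_decode (N : nat) (t : GenTree.tree unit) : option (ptree N) :=
  if t is GenTree.Node c ts then
    omap (fun c' => PNode c' (pmap id (map (ptree_decode N) ts))) (insub c)
  else None.

Lemma ptree_encodeK (N : nat) : pcancel (@ptree_encode N) (ptree_decode N).
Proof.
elim/ptree_ind' => c ts IH /=; rewrite valK /= -map_comp; congr (Some (PNode _ _)).
by elim: IH => //= t us -> _ ->.
Qed.

HB.instance Definition _ (N : nat) :=
  Countable.copy (ptree N) (pcan_type (@ptree_encodeK N)).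

(* An unordered tree is represented by the plane tree in its isomorphism class
   in which the children of every node are sorted, for the total order on
   ptree N given by pickle; see canonical_exists and canonical_unique. *)
Definition ptree_le (N : nat) : rel (ptree N) := relpre pickle leq.

Fixpoint canonical (N : nat) (t : ptree N) : bool :=
  let: PNode _ ts := t in sorted (@ptree_le N) ts && all (@canonical N) ts.

Fixpoint tree_size (N : nat) (t : ptree N) : nat :=
  let: PNode _ ts := t in (sumn (map (@tree_size N) ts)).+1.

Definition NT (N : nat) : set (ptree N) := [set t | canonical t].
Arguments NT N : clear implicits.

Definition NTq (N q : nat) : set (ptree N) :=
  [set t | NT N t /\ (tree_size t <= q)%N].
Arguments NTq N q : clear implicits.

Inductive tree_iso (N : nat) : ptree N -> ptree N -> Prop :=
  TreeIso c ts us vs of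
    List.Forall2 (@tree_iso N) ts us & perm_eq us vs :
    tree_iso (PNode c ts) (PNode c vs).

(* The symmetries are computed before the multiplicities are counted in order
   to satisfy the guard condition; see sigmaE for the usual recursion. *)
Fixpoint sigma (N : nat) (t : ptree N) : nat :=
  let: PNode _ ts := t in
  let ws := map (fun t' => (t', sigma t')) ts in
  (\prod_(w <- undup ws) ((count_mem w ws)`! * w.2 ^ count_mem w ws))%N.

Section ElementaryDifferentials.
Context {R : realType} {d : nat}.
Implicit Types f : 'rV[R]_d -> 'rV[R]_d.

Definition partial (i : 'I_d) f : 'rV[R]_d -> 'rV[R]_d :=
  fun x => 'D_(delta_mx 0 i) f x.

Definition partials (s : seq 'I_d) f : 'rV[R]_d -> 'rV[R]_d :=
  foldr partial f s.

Definition class_C (k : nat) f : Prop :=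
  forall s : seq 'I_d, (size s <= k)%N ->
    continuous (partials s f) /\
    ((size s < k)%N ->
      forall i x, derivable (partials s f) x (delta_mx 0 i)).

Fixpoint elemdiff (N : nat) (f : 'I_N -> 'rV[R]_d -> 'rV[R]_d)
    (t : ptree N) (y : 'rV[R]_d) : 'rV[R]_d :=
  let: PNode c ts := t in
  let Fs := map (fun t' => elemdiff f t' y) ts in
  \sum_(i : (size ts).-tuple 'I_d)
    (\prod_(k < size ts) Fs`_k 0 (tnth i k)) *: partials i (f c) y.

End ElementaryDifferentials.

Section NSARK.
Context {R : realType} {d N s : nat}.
Implicit Types (f : 'I_N -> 'rV[R]_d -> 'rV[R]_d) (y : 'rV[R]_d) (h : R).
Implicit Types (A : 'I_N -> 'M[R]_s) (B : 'I_N -> 'rV[R]_s).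
Implicit Types Y : 'I_s -> 'rV[R]_d.

Definition nsark_stages f A y h Y : Prop :=
  forall i, Y i = y + h *: \sum_(j < s) \sum_(nu < N) A nu i j *: f nu (Y j).

Definition nsark_output f B y h Y : 'rV[R]_d :=
  y + h *: \sum_(j < s) \sum_(nu < N) B nu 0 j *: f nu (Y j).

Definition tree_series f (p : nat) (c : ptree N -> R) y h : 'rV[R]_d :=
  \sum_(t \in NTq N p)
    (h ^+ tree_size t / (sigma t)%:R * c t) *: elemdiff f t y.

(* The functions d_i are unfolded inside the recursion; see gcoefE. *)
Fixpoint gcoef A (t : ptree N) (i : 'I_s) (nu : 'I_N) : R :=
  let: PNode mu ts := t in
  (nu == mu)%:R *
  \prod_(x <- map (fun t' => \sum_(nu' < N) \sum_(j < s)
                     A nu' i j * gcoef A t' j nu') ts) x.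

Definition dcoef A (t : ptree N) (i : 'I_s) : R :=
  \sum_(nu < N) \sum_(j < s) A nu i j * gcoef A t j nu.

Definition ucoef A B (t : ptree N) : R :=
  \sum_(nu < N) \sum_(i < s) B nu 0 i * gcoef A t i nu.

Lemma gcoefE A mu ts i nu :
  gcoef A (PNode mu ts) i nu = (nu == mu)%:R * \prod_(t <- ts) dcoef A t i.
Proof. by rewrite /= big_map. Qed.

End NSARK.

Lemma elemdiff_bullet (R : realType) (d N : nat)
    (f : 'I_N -> 'rV[R]_d -> 'rV[R]_d) (nu : 'I_N) (y : 'rV[R]_d) :
  elemdiff f (PNode nu [::]) y = f nu y.
Proof.
rewrite /= (big_pred1 [tuple]) => [|i]; first by rewrite big_ord0 scale1r.
by apply/esym/eqP; exact: tuple0.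
Qed.

Lemma sigmaE (N : nat) (c : 'I_N) (ts : seq (ptree N)) :
  sigma (PNode c ts) =
  (\prod_(t <- undup ts) ((count_mem t ts)`! * sigma t ^ count_mem t ts))%N.
Proof.
pose g (t : ptree N) := (t, sigma t).
have g_inj : injective g by move=> x y [].
rewrite /= -/g undup_map_inj // big_map; apply: eq_bigr => t _ /=.
suff -> : count_mem (t, sigma t) (map g ts) = count_mem t ts by [].
by rewrite count_map; apply: eq_count => x /=; rewrite -[(t, _)]/(g t) (inj_eq g_inj).
Qed.

Lemma ptree_le_total (N : nat) : total (@ptree_le N).
Proof. by move=> x y; apply: leq_total. Qed.

Lemma ptree_le_trans (N : nat) : transitive (@ptree_le N).
Proof. by move=> y x z; apply: leq_trans. Qed.

Lemma ptree_le_anti (N : nat) : antisymmetric (@ptree_le N).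
Proof.
move=> x y; rewrite /ptree_le /= -eqn_leq => /eqP.
exact: (pcan_inj (@pickleK (ptree N))).
Qed.

Lemma canonical_exists (N : nat) (t : ptree N) :
  exists2 t', NT N t' & tree_iso t t'.
Proof.
elim/ptree_ind': t => c ts IH.
have [us [tsus cus]] :
    exists us, List.Forall2 (@tree_iso N) ts us /\ all (@canonical N) us.
  elim: IH => [|t {}ts [t' ct it] _ [us [IHi IHc]]].
    by exists [::]; split; [constructor|].
  by exists (t' :: us); split; [constructor|rewrite /= ct].
exists (PNode c (sort (@ptree_le N) us)); last first.
  by apply: TreeIso tsus _; rewrite perm_sym perm_sort.
rewrite /NT /= sort_sorted; last exact: ptree_le_total.
by rewrite all_sort.
Qed.

Lemma canonical_unique (N : nat) (t1 t2 : ptree N) :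
  NT N t1 -> NT N t2 -> tree_iso t1 t2 -> t1 = t2.
Proof.
rewrite /NT /=.
elim/ptree_ind': t1 t2 => c ts IH t2 c1 c2 it.
inversion it as [c' ts' us vs iu pu e1 e2]; subst.
move: c1 c2 => /= /andP[s1 a1] /andP[s2 a2].
suff e : ts = us.
  by subst us; congr PNode; apply: (sorted_eq (@ptree_le_trans N) (@ptree_le_anti N)).
have {}a2 : all (@canonical N) us by rewrite (perm_all _ pu).
elim: iu IH a1 a2 {it pu s1 s2} => //= t u ts' us' itu _ IHu IHt.
inversion IHt as [|? ? Ht Hts]; subst.
by move=> /andP[ct cts] /andP[cu cus]; rewrite (Ht u) // IHu.
Qed.

Lemma bounded_seqs (T : eqType) (E : seq T) (n : nat) :
  exists S : seq (seq T),
    forall ts, (size ts <= n)%N -> {subset ts <= E} -> ts \in S.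
Proof.
elim: n => [|n [S HS]]; first by exists [:: [::]] => -[].
exists ([::] :: [seq t :: ts | t <- E, ts <- S]) => -[//|t ts] /= sz tsE.
rewrite inE /=; apply: allpairs_f; first by apply: tsE; rewrite mem_head.
by apply: HS => // x xts; apply: tsE; rewrite inE xts orbT.
Qed.

Lemma bounded_ptrees (N q : nat) :
  exists E : seq (ptree N), forall t, (tree_size t <= q)%N -> t \in E.
Proof.
elim: q => [|q [E HE]]; first by exists [::] => -[].
have [S HS] := bounded_seqs E q.
exists [seq PNode c ts | c <- enum 'I_N, ts <- S] => -[c ts] /=.
rewrite ltnS => tsq; apply: allpairs_f; first by rewrite mem_enum.
apply: HS.
  apply: leq_trans tsq; elim: ts => //= -[c' us] ts IH /=.
  by rewrite addSn ltnS (leq_trans IH) // leq_addl.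
move=> t tts; apply: HE; apply: leq_trans tsq.
elim: ts tts => //= u ts IH; rewrite inE => /orP[/eqP->|/IH].
  exact: leq_addr.
by move/leq_trans; apply; apply: leq_addl.
Qed.

(* The finitely supported sums over NTq N q are thus genuine sums. *)
Lemma finite_NTq (N q : nat) : finite_set (NTq N q).
Proof.
have [E HE] := bounded_ptrees N q.
apply: (@sub_finite_set _ _ [set` E]); last exact: finite_seq.
by move=> t [_ /HE].
Qed.

(* Main.v *)
Require Import Defs.
From mathcomp Require Import all_boot all_order all_algebra.
From mathcomp Require Import all_classical all_reals all_analysis.
From mathcomp Require Import ring lra.

Import Order.TTheory GRing.Theory Num.Theory.
Import numFieldNormedType.Exports.

Local Open Scope classical_set_scope.
Local Open Scope ring_scope.

(** Write [delta] for the displacement [Y h i - y] of a stage.  Everything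
follows from one bootstrap on the order [q].

If the stage derivatives [h *: f nu (Y h j)] are known up to [O(h^(q+1))],
the stage equations, which are linear in them with bounded coefficients, give
[delta] up to [O(h^(q+1))], with [gcoef] replaced by [dcoef]; the output is
treated in the same way ([combine_stages]).  Conversely, if [delta] is known
up to [O(h^(q+1))], Taylor's formula gives [f nu (y + delta)] up to
[O(h^(q+1))], and the factor [h] in front of the stage derivative gains one
order ([deriv_expansionS]).  The start is [h *: f nu (Y h i) = O(h)]: by the
Lipschitz condition the stages stay bounded ([stages_bounded]), since
[delta] is at most [h] times a constant times [1 + delta].

Trees appear when the known part of [delta], a sum over trees [t] of
[c t *: F t], is inserted into the Taylor polynomial ([expansion]).  By
multilinearity the term of degree [l] becomes a sum over words of [l] trees,
divided by [l!] ([dform_sum]).  The derivative form is symmetric by Schwarz's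
theorem ([schwarz], [dform_perm]), so the words with the same letters can be
gathered; there are [l!] over the product of the factorials of the
multiplicities of them ([multinomial], [sum_words_div]).  A sorted word of
canonical trees is the list of children of one canonical tree, the quotient by
the multiplicities is the part of [sigma] contributed by the root, and the
words of total size above [q] only contribute to the remainder
([sum_trees], [sigma_mult]).

Taylor's formula itself is proved by induction on the order: a partial
derivative of the remainder of [g] is the remainder of a partial derivative
of [g], one order lower ([taylor_bound]). *)

(** * Partial derivatives and Taylor's formula for scalar functions *)

Section Calculus.
Context {R : realType} {d : nat}.
Implicit Types (g : 'rV[R]_d -> R) (x y v w : 'rV[R]_d).

Definition pd (i : 'I_d) g : 'rV[R]_d -> R := fun x => 'D_(delta_mx 0 i) g x.

Definition pds (s : seq 'I_d) g : 'rV[R]_d -> R := foldr pd g s.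

(** The scalar counterpart of [class_C].  The calculus is done entry by entry,
because for scalar functions the mean value theorem is an equality. *)
Definition smooth (k : nat) g : Prop :=
  forall s : seq 'I_d, (size s <= k)%N ->
    continuous (pds s g) /\
    ((size s < k)%N -> forall i x, derivable (pds s g) x (delta_mx 0 i)).

Lemma smoothW m n g : (m <= n)%N -> smooth n g -> smooth m g.
Proof.
move=> mn gs s sm; have [gc gd] := gs s (leq_trans sm mn).
by split=> // sm'; apply: gd; exact: leq_trans sm' mn.
Qed.

Lemma smooth_pd k g i : smooth k.+1 g -> smooth k (pd i g).
Proof.
move=> gs s sk; have := gs (rcons s i).
by rewrite size_rcons /pds foldr_rcons => /(_ sk).
Qed.

Lemma smooth_continuous k g : smooth k g -> continuous g.
Proof. by move=> /(_ [::]) /= []. Qed.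

Lemma smooth_derivable k g x i : smooth k.+1 g -> derivable g x (delta_mx 0 i).
Proof. by move=> /(_ [::]) /= [//|_]; apply. Qed.

Lemma normv_le v (C : R) : 0 <= C -> (forall j, `|v 0 j| <= C) -> `|v| <= C.
Proof.
move=> C0 vC; rewrite /Num.Def.normr /= mx_normrE.
by apply: bigmax_le => // -[i j] _ /=; rewrite ord1.
Qed.

Lemma normv_ge v j : `|v 0 j| <= `|v|.
Proof.
rewrite [leRHS]/Num.Def.normr /= mx_normrE.
exact: (le_bigmax _ (fun ij => `|v ij.1 ij.2|) (0, j)).
Qed.

Lemma is_derive_line g x v (t : R) :
  derivable g (x + t *: v) v ->
  is_derive t 1 (fun t => g (x + t *: v)) ('D_v g (x + t *: v)).
Proof.
have E : (fun h : R => h^-1 *: (((fun t => g (x + t *: v)) \o shift t) (h *: 1)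
            - g (x + t *: v))) =
         (fun h => h^-1 *: ((g \o shift (x + t *: v)) (h *: v) - g (x + t *: v))).
  apply/funext => h /=; congr (_ *: (g _ - _)).
  by rewrite [h *: 1]mulr1 scalerDl addrCA.
by move=> gd; split; [rewrite /derivable E | rewrite /derive E].
Qed.

Lemma is_derive_shift g y x v : derivable g (y + x) v ->
  is_derive x v (fun x => g (y + x)) ('D_v g (y + x)).
Proof.
have E : (fun h : R => h^-1 *: (((fun x => g (y + x)) \o shift x) (h *: v)
            - g (y + x))) =
         (fun h => h^-1 *: ((g \o shift (y + x)) (h *: v) - g (y + x))).
  by apply/funext => h /=; congr (_ *: (g _ - _)); rewrite addrCA.
by move=> gd; split; [rewrite /derivable E | rewrite /derive E].
Qed.

(** The sign of [a] is left free, so that increments in both directions along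
an axis are covered. *)
Lemma mvt_from0 (phi dphi : R -> R) (a : R) :
  (forall t : R, is_derive t 1 phi (dphi t)) ->
  exists2 c, `|c| <= `|a| & phi a - phi 0 = dphi c * a.
Proof.
move=> dp.
have cp : continuous phi.
  move=> t; apply/differentiable_continuous/derivable1_diffP.
  by case: (dp t).
have [a0|a0] := leP 0 a.
  have [c] := MVT_segment a0 (fun t _ => dp t) (continuous_subspaceT cp).
  rewrite in_itv /= => /andP[c0 ca]; rewrite subr0 => e.
  by exists c => //; rewrite !ger0_norm.
have [c] := MVT_segment (ltW a0) (fun t _ => dp t) (continuous_subspaceT cp).
rewrite in_itv /= => /andP[ac c0] e; exists c.
  by rewrite ler0_norm // ltr0_norm // lerN2.
by rewrite -opprB e sub0r mulrN opprK.
Qed.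

Lemma norm_delta (i : 'I_d) : `|delta_mx 0 i : 'rV[R]_d| <= 1.
Proof.
by apply: normv_le => // j; rewrite mxE eqxx /=; case: eqP; rewrite ?normr1 ?normr0.
Qed.

(** Two applications of the mean value theorem to the second difference over
the square with corner [x] and sides [t *: e_i], [t *: e_j].  The position of
the intermediate point does not matter, as [t] will tend to 0. *)
Lemma pd_square g (i j : 'I_d) x (t : R) : smooth 2 g ->
  exists2 z, `|z| <= `|t| *+ 2 &
    g (x + t *: delta_mx 0 j + t *: delta_mx 0 i) - g (x + t *: delta_mx 0 i)
    - (g (x + t *: delta_mx 0 j) - g x) = pd j (pd i g) (x + z) * t * t.
Proof.
move=> gs; set ei := delta_mx 0 i; set ej := delta_mx 0 j.
(* The first mean value theorem runs along e_i, the second along e_j. *)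
pose phi s := g (x + t *: ej + s *: ei) - g (x + s *: ei).
pose dphi s := pd i g (x + t *: ej + s *: ei) - pd i g (x + s *: ei).
have dp (s : R) : is_derive s 1 phi (dphi s).
  by apply: is_deriveB; apply: is_derive_line; apply: (smooth_derivable 1).
have [c ct /=] := mvt_from0 phi dphi t dp.
rewrite /phi /dphi scale0r !addr0 => ->.
have dp2 (s : R) : is_derive s 1 (fun s => pd i g (x + c *: ei + s *: ej))
   (pd j (pd i g) (x + c *: ei + s *: ej)).
  by apply: is_derive_line; apply: (smooth_derivable 0); apply: smooth_pd.
have [c' ct' /=] := mvt_from0 _ _ t dp2.
rewrite scale0r addr0 => e2; exists (c *: ei + c' *: ej).
  rewrite mulr2n (le_trans (ler_normD _ _)) // lerD // normrZ.
    by rewrite -[leRHS]mulr1 ler_pM // norm_delta.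
  by rewrite -[leRHS]mulr1 ler_pM // norm_delta.
by rewrite addrA -e2 addrAC.
Qed.

(** The second difference of [pd_square] is symmetric in [i] and [j], so the two
mixed derivatives agree at two points arbitrarily close to [x]; they are
continuous, hence they agree at [x]. *)
Lemma schwarz g (i j : 'I_d) : smooth 2 g -> pd i (pd j g) = pd j (pd i g).
Proof.
move=> gs; apply/funext => x; apply/eqP; rewrite -subr_eq0 -normr_le0.
have cont a b : {for x, continuous (pd a (pd b g))}.
  exact/(@smooth_continuous 0)/smooth_pd/smooth_pd.
apply/ler_addgt0Pl => e e0; rewrite addr0.
have close (A B C : R) : `|A - C| < e / 2 -> `|B - C| < e / 2 -> `|A - B| <= e.
  move=> AC BC; rewrite -(subrKA C) (le_trans (ler_normD _ _)) // [leRHS]splitr.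
  by rewrite lerD // ltW // distrC.
have /cvgrPdist_lt /(_ _ (divr_gt0 e0 (ltr0n _ 2))) := cont i j.
have /cvgrPdist_lt /(_ _ (divr_gt0 e0 (ltr0n _ 2))) := cont j i.
move=> /nbhs_ballP[r1 /= r10 B1] /nbhs_ballP[r2 /= r20 B2].
have [t t0 [tr1 tr2]] : exists2 t : R, 0 < t & t *+ 2 < r1 /\ t *+ 2 < r2.
  have m0 : 0 < Num.min r1 r2 by rewrite lt_min r10.
  (* The intermediate points are within 2t of x. *)
  exists (Num.min r1 r2 / 3); first by rewrite divr_gt0.
  apply/andP; rewrite -lt_min -(mulr_natr (_ / _)) mulrAC ltr_pdivrMr //.
  by rewrite ltr_pM2l // ltr_nat.
have [z1 z1t e1] := pd_square g i j x t gs.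
have [z2 z2t e2] := pd_square g j i x t gs.
have E : pd j (pd i g) (x + z1) = pd i (pd j g) (x + z2).
  apply: (mulIf (lt0r_neq0 t0)); apply: (mulIf (lt0r_neq0 t0)).
  apply: etrans (esym e1) _; apply: etrans _ e2.
  rewrite [x + t *: delta_mx 0 i + _]addrAC !opprB addrACA [RHS]addrACA.
  by congr (_ + _); rewrite addrC.
have ballz z r : t *+ 2 < r -> `|z| <= `|t| *+ 2 -> ball x r (x + z).
  move=> rr; rewrite (gtr0_norm t0) => zt.
  rewrite -ball_normE /= opprD addrA subrr sub0r normrN.
  exact: le_lt_trans rr.
have := B1 _ (ballz z1 r1 tr1 z1t).
have := B2 _ (ballz z2 r2 tr2 z2t).
rewrite /= E; move: (pd i (pd j g) (x + z2)) => C; exact: close.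
Qed.

(** The derivative of [g] at [y] of order [size vs], as a multilinear form
evaluated at [vs]; the head of [vs] goes with the derivative taken first.  The
recursion on the arguments replaces sums over tuples of indices. *)
Fixpoint dform (vs : seq 'rV[R]_d) g y : R :=
  if vs is v :: vs' then \sum_k v 0 k * dform vs' (pd k g) y else g y.

Lemma dform_move us v vs g y : smooth (size us + size vs).+1 g ->
  dform (us ++ v :: vs) g y = dform (v :: us ++ vs) g y.
Proof.
elim: us g => // u us IH g gs /=.
under eq_bigr => k _ do rewrite (IH _ (smooth_pd _ _ _ gs)) /= mulr_sumr.
rewrite exchange_big /=; apply: eq_bigr => k _; rewrite mulr_sumr.
apply: eq_bigr => j _; rewrite mulrCA schwarz //.
by apply: smoothW gs; rewrite /= !ltnS.
Qed.

(** Repeated use of Schwarz's theorem.  This is what lets an unordered tree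
carry a well-defined elementary differential, and lets rearranged words be
gathered. *)
Lemma dform_perm us vs g y : smooth (size us) g -> perm_eq us vs ->
  dform us g y = dform vs g y.
Proof.
elim: us vs g => [|u us IH] vs g gs.
  by rewrite perm_sym => /perm_nilP ->.
move=> pe; have uvs : u \in vs by rewrite -(perm_mem pe) mem_head.
case/splitPr: uvs pe => v1 v2 pe.
have pe' : perm_eq us (v1 ++ v2).
  by rewrite -(perm_cons u) (permPl pe) -cat1s perm_catCA.
rewrite dform_move /=; last by rewrite -size_cat -(perm_size pe').
by apply: eq_bigr => k _; rewrite (IH _ _ (smooth_pd _ _ _ gs) pe').
Qed.

(** The derivative form is symmetric, so each of its [l.+1] equal arguments
contributes the same term. *)
Lemma is_derive_dform_nseq l g y i x : smooth l.+1 g ->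
  is_derive x (delta_mx 0 i) (fun x => dform (nseq l.+1 x) g y)
    (l.+1%:R * dform (nseq l x) (pd i g) y).
Proof.
have dc k : is_derive x (delta_mx 0 i) (fun x : 'rV[R]_d => x 0 k) ((k == i)%:R).
  have h : is_derive x (delta_mx 0 i) (@idfun 'rV[R]_d) (delta_mx 0 i).
    exact: is_derive_id.
  split; first by have /derivable_mxP := @ex_derive _ _ _ _ _ _ _ h; apply.
  have := derive_mx (@ex_derive _ _ _ _ _ _ _ h).
  by rewrite derive_val => /matrixP/(_ 0 k); rewrite !mxE eqxx.
elim: l g => [|l IH] g gs /=.
  rewrite mul1r.
  have -> : (fun x : 'rV_d => \sum_k x 0 k * pd k g y) =
            \sum_(k < d) ((fun x : 'rV[R]_d => x 0 k) * cst (pd k g y)).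
    by apply/funext => z; rewrite fct_sumE.
  apply: is_derive_eq.
  under eq_bigr => k _ do rewrite scaler0 add0r.
  rewrite (bigD1 i) //= eqxx big1 ?addr0 => [|k ki]; first exact: mulr1.
  by rewrite (negPf ki) scaler0.
have -> : (fun x : 'rV_d =>
             \sum_k x 0 k * \sum_j x 0 j * dform (nseq l x) (pd j (pd k g)) y) =
   \sum_(k < d) ((fun x : 'rV[R]_d => x 0 k) *
                 (fun x => dform (nseq l.+1 x) (pd k g) y)).
  by apply/funext => z; rewrite fct_sumE.
have IHk k := IH (pd k g) (smooth_pd _ _ _ gs).
apply: is_derive_eq.
rewrite big_split /= [X in _ + X](bigD1 i) //= eqxx.
rewrite [X in _ + (_ + X)]big1; last first.
  by move=> k ki; rewrite (negPf ki) scaler0.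
rewrite addr0 [_ *: 1]mulr1 -[l.+2%:R]natr1 mulrDl mul1r; congr (_ + _).
rewrite [RHS]mulr_sumr; apply: eq_bigr => k _.
have -> : pd i (pd k g) = pd k (pd i g) by apply: schwarz; exact: smoothW gs.
exact: (mulrCA (x 0 k)).
Qed.

(** The path from 0 to [w] that changes one coordinate at a time stays in the
ball of radius [`|w|] for the sup norm, and the mean value theorem applies on
each of its [d] segments. *)
Lemma increment_le g (K : R) w :
  (forall x i, derivable g x (delta_mx 0 i)) -> 0 <= K ->
  (forall z i, `|z| <= `|w| -> `|pd i g z| <= K) ->
  `|g w - g 0| <= (K * `|w|) *+ d.
Proof.
move=> gd K0 gK.
(* The vertices of the path: W 0 = 0 and W d = w. *)
pose W m : 'rV[R]_d := \row_j (if (j < m)%N then w 0 j else 0).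
have W0 : W 0%N = 0 by apply/rowP => j; rewrite !mxE.
have Wd : W d = w by apply/rowP => j; rewrite !mxE ltn_ord.
rewrite -{1}Wd -W0 -(telescope_sumr (fun m => g (W m))) // big_mkord.
apply: le_trans (ler_norm_sum _ _ _) _.
have -> : (K * `|w|) *+ d = \sum_(m < d) (K * `|w|) by rewrite sumr_const card_ord.
apply: ler_sum => m _.
have -> : W m.+1 = W m + w 0 m *: delta_mx 0 m.
  apply/rowP => j; rewrite !mxE eqxx /= ltnS leq_eqVlt.
  case: ltngtP => [jm|mj|/val_inj ->] //=.
  - by rewrite (_ : (j == m) = false) ?mulr0 ?addr0 // -(inj_eq val_inj) ltn_eqF.
  - by rewrite (_ : (j == m) = false) ?mulr0 ?addr0 // -(inj_eq val_inj) gtn_eqF.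
  - by rewrite eqxx mulr1 add0r.
have dp (s : R) : is_derive s 1 (fun s => g (W m + s *: delta_mx 0 m))
   (pd m g (W m + s *: delta_mx 0 m)) by exact: is_derive_line.
have [c cw] := mvt_from0 _ _ (w 0 m) dp.
rewrite scale0r addr0 => ->; rewrite normrM ler_pM ?normv_ge //.
apply: gK; apply: normv_le => // j; rewrite !mxE eqxx /=.
case: (ltngtP j m) => [jm|mj|/val_inj ->].
- rewrite (_ : (j == m) = false) ?mulr0 ?addr0 ?normv_ge //.
  by rewrite -(inj_eq val_inj) ltn_eqF.
- rewrite (_ : (j == m) = false) ?mulr0 ?addr0 ?normr0 //.
  by rewrite -(inj_eq val_inj) gtn_eqF.
- by rewrite eqxx mulr1 add0r (le_trans cw) // normv_ge.
Qed.

Definition taylor (p : nat) g y w : R :=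
  \sum_(l < p) dform (nseq l w) g y / (l`!)%:R.

(** Induction on [p]: the derivative of the remainder [G] in a coordinate
direction is the remainder of order [p] of a partial derivative of [g], which
is [O(|w|^p)]; integrating along the axes gains one power. *)
Lemma taylor_bound p g y : smooth p g ->
  exists (C r : R), [/\ 0 <= C, 0 < r & forall w, `|w| < r ->
    `|g (y + w) - taylor p g y w| <= C * `|w| ^+ p].
Proof.
elim: p g => [|p IH] g gs.
  have /cvgrPdist_lt /(_ 1 ltr01) := smooth_continuous _ _ gs y.
  move=> /nbhs_ballP[r /= r0 B]; exists (`|g y| + 1), r; split=> // w wr.
  rewrite /taylor big_ord0 subr0 expr0 mulr1 -(subrK (g y) (g (y + w))) addrC.
  rewrite (le_trans (ler_normD _ _)) // lerD // distrC ltW //.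
  by apply: B; rewrite -ball_normE /= opprD addrA subrr sub0r normrN.
have /choice[C /choice[r HC]] i := IH (pd i g) (smooth_pd _ _ _ gs).
exists ((\sum_i C i) *+ d), (\big[Num.min/1]_i r i).
have C0 : 0 <= \sum_i C i by apply: sumr_ge0 => i _; case: (HC i).
split; first exact: mulrn_wge0.
  by elim/big_ind: _ => // [a b a0 b0|i _]; [rewrite lt_min a0|case: (HC i)].
move=> w wr.
pose T l x := dform (nseq l x) g y / (l`!)%:R.
pose G := (fun x => g (y + x)) - (fun x => taylor p.+1 g y x).
have dT (l : 'I_p.+1) i x : is_derive x (delta_mx 0 i) (T l)
    (if (l : nat) is l'.+1 then dform (nseq l' x) (pd i g) y / (l'`!)%:R else 0).
  case: l => -[|l] /= lp.
    rewrite /T /= ; exact: is_derive_cst.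
  have := is_derive_dform_nseq l g y i x (smoothW _ _ _ (ltnW lp) gs).
  move=> /(is_deriveZ ((l.+1)`!%:R^-1)).
  have -> : (l.+1)`!%:R^-1 \*: (fun x => dform (nseq l.+1 x) g y) = T l.+1.
    by apply/funext => z; rewrite /T /= [LHS]mulrC.
  move=> [dD dE]; split=> //; rewrite dE.
  rewrite factS natrM; move: (dform _ _ _) => D.
  rewrite -[LHS]/((_ * _)^-1 * (_ * D)) invfM mulrACA mulVf ?pnatr_eq0 //.
  by rewrite mul1r mulrC.
have dG i x : is_derive x (delta_mx 0 i) G
   (pd i g (y + x) - taylor p (pd i g) y x).
  apply: is_deriveB.
    apply: is_derive_shift; exact: smooth_derivable gs.
  have -> : taylor p.+1 g y = \sum_(l < p.+1) T l.
    by apply/funext => z; rewrite fct_sumE.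
  have := is_derive_sum (fun l => dT l i x).
  move=> [dD dE]; split=> //; rewrite dE.
  by rewrite big_ord_recl add0r.
have G0 : G 0 = 0.
  rewrite /G /= {1}/GRing.add /= {1}/GRing.opp /= addr0 /taylor big_ord_recl /=.
  rewrite fact0 divr1 big1 ?addr0 ?subrr // => l _.
  by rewrite big1 ?mul0r // => k _; rewrite mxE mul0r.
have -> : g (y + w) - taylor p.+1 g y w = G w - G 0 by rewrite G0 subr0.
have -> : (\sum_i C i) *+ d * `|w| ^+ p.+1 = ((\sum_i C i) * `|w| ^+ p * `|w|) *+ d.
  by rewrite exprSr mulrA !mulrnAl.
apply: increment_le; first by move=> x i; case: (dG i x).
  by rewrite mulr_ge0 // exprn_ge0.
move=> z i zw; have [Ci ri Hi] := HC i.
have -> : pd i G z = pd i g (y + z) - taylor p (pd i g) y z.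
  exact: derive_val.
apply: le_trans (Hi z _) _.
  apply: le_lt_trans zw (lt_le_trans wr _).
  exact: bigmin_le.
apply: ler_pM; rewrite ?exprn_ge0 //; last by rewrite lerXn2r ?nnegrE.
rewrite (bigD1 i) //= lerDl; apply: sumr_ge0 => j _; by case: (HC j).
Qed.

End Calculus.

(** * Words and their rearrangements *)

Section Words.
Context {T : eqType}.
Implicit Types (s w : seq T) (E : seq T).

(** The number of permutations of the positions of [s] that fix [s]. *)
Definition mult s : nat := (\prod_(x <- undup s) (count_mem x s)`!)%N.

(** Letters that do not occur contribute [0! = 1].  This allows [mult s] and
[mult (rem x s)] to be compared as products over the same list. *)
Lemma mult_sub s r : uniq r -> {subset s <= r} ->
  mult s = (\prod_(x <- r) (count_mem x s)`!)%N.
Proof.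
move=> ur sr; rewrite (bigID (mem s)) /= [X in (_ * X)%N]big1 ?muln1; last first.
  by move=> x xs; rewrite (count_memPn xs).
rewrite -big_filter; apply: perm_big; apply: uniq_perm;
  rewrite ?undup_uniq ?filter_uniq //.
move=> x; rewrite mem_filter mem_undup; case: (boolP (x \in s)) => // xs.
by rewrite sr.
Qed.

Lemma mult_rem x s : x \in s -> mult s = (count_mem x s * mult (rem x s))%N.
Proof.
move=> xs; have us := undup_uniq s.
have xu : x \in undup s by rewrite mem_undup.
rewrite (mult_sub (rem x s) _ us) => [|y yr]; last by rewrite mem_undup (mem_rem yr).
have cr y : count_mem y (rem x s) = (count_mem y s - (x == y))%N.
  by rewrite count_rem xs.
rewrite /mult !(bigD1_seq x) //= cr eqxx mulnA; congr (_ * _)%N.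
  have : (0 < count_mem x s)%N by rewrite -has_count has_pred1.
  by case: (count_mem x s) => // n _; rewrite factS subn1.
by apply: eq_bigr => y yx; rewrite cr eq_sym (negPf yx) subn0.
Qed.

(** Induction on the size, splitting the permutations of [s] by their first
letter. *)
Lemma multinomial s : (size (permutations s) * mult s)%N = (size s)`!.
Proof.
elim: {s}(size s) {-2}s (erefl (size s)) => [|n IH] s sn.
  by move/size0nil: sn => ->; rewrite /mult /= big_nil muln1.
rewrite (perm_size (permutationsE _)) ?sn // size_allpairs_dep.
rewrite sumnE big_map big_distrl /= factS.
rewrite (eq_big_seq (fun x => (count_mem x s * n`!)%N)) => [|x]; last first.
  rewrite mem_undup => xs; rewrite (mult_rem _ _ xs) mulnCA.
  by rewrite IH size_rem // sn.
transitivity ((\sum_(x <- undup s) count_mem x s) * n`!)%N.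
  by rewrite big_distrl.
rewrite -sn -[in RHS](perm_size (perm_count_undup s)).
rewrite size_flatten sumnE !big_map; congr (_ * _)%N.
by apply: eq_bigr => x _; rewrite size_nseq.
Qed.

Fixpoint words E l : seq (seq T) :=
  if l is l'.+1 then [seq t :: w | t <- E, w <- words E l'] else [:: [::]].

Lemma mem_words E l w : (w \in words E l) = (size w == l) && all (mem E) w.
Proof.
elim: l w => [|l IH] [|x w] //=.
  by apply/negP => /allpairsP[[a b] [_ _]].
rewrite eqSS andbCA -IH.
apply/allpairsP/andP => [[[a b] /= [aE bw [-> ->]]] //|[xE ww]].
by exists (x, w).
Qed.

Lemma words_uniq E l : uniq E -> uniq (words E l).
Proof.
move=> uE; elim: l => //= l IH; apply: allpairs_uniq => //.
by move=> [a b] [a' b'] _ _ [-> ->].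
Qed.

(** Each word is counted through its sorted rearrangement, and a sorted word
represents as many words as it has permutations. *)
Lemma sum_words_sorted (R : comNzRingType) (le : rel T) E l (G : seq T -> R) :
    total le -> transitive le -> antisymmetric le -> uniq E ->
    (forall w w', perm_eq w w' -> all (mem E) w -> G w = G w') ->
  \sum_(w <- words E l) G w =
  \sum_(w <- words E l | sorted le w) (size (permutations w))%:R * G w.
Proof.
move=> lt ltr la uE Gp; have uW := words_uniq E l uE.
have Eperm w w' : perm_eq w w' -> w \in words E l -> w' \in words E l.
  by move=> pw; rewrite !mem_words (perm_size pw) (perm_all _ pw).
transitivity (\sum_(w <- words E l)
    \sum_(v <- words E l | sorted le v && perm_eq v w) G w).
  apply: eq_big_seq => w ww; rewrite (eq_bigl (pred1 (sort le w))) => [|v].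
    rewrite -big_filter filter_pred1_uniq ?big_seq1 // (Eperm w) //.
    by rewrite perm_sym perm_sort.
  apply/andP/eqP => [[sv vw]|->]; last by rewrite sort_sorted // perm_sort.
  apply: (sorted_eq ltr la) => //; first exact: sort_sorted.
  by rewrite (permPl vw) perm_sym perm_sort.
rewrite (exchange_big_dep (sorted le)) /=; last by move=> w v _ /andP[].
rewrite big_seq_cond [RHS]big_seq_cond; apply: eq_bigr => v /andP[vw sv].
rewrite (eq_bigl (perm_eq v)) => [|w]; last by rewrite sv.
transitivity (\sum_(w <- words E l | perm_eq v w) G v).
  apply: eq_bigr => w vw'; apply/esym/Gp => //.
  by move: vw; rewrite mem_words => /andP[].
rewrite -big_filter big_const_seq count_predT iter_addr_0 mulr_natl.
congr (_ *+ _); apply: perm_size; apply: uniq_perm.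
- exact: filter_uniq.
- exact: permutations_uniq.
move=> w; rewrite mem_filter mem_permutations perm_sym andb_idr // => wv.
by apply: Eperm vw; rewrite perm_sym.
Qed.

Lemma sum_words_div (R : numFieldType) (le : rel T) E l (G : seq T -> R) :
    total le -> transitive le -> antisymmetric le -> uniq E ->
    (forall w w', perm_eq w w' -> size w = l -> G w = G w') ->
  (\sum_(w <- words E l) G w) / (l`!)%:R =
  \sum_(w <- words E l | sorted le w) G w / (mult w)%:R.
Proof.
move=> lt ltr la uE Gp.
(* G is only symmetric on words of size l; outside it is replaced by 0. *)
pose G' w := if size w == l then G w else 0.
have GG w : w \in words E l -> G w = G' w.
  by rewrite mem_words /G' => /andP[->].
rewrite (eq_big_seq G') // (sum_words_sorted _ le) // => [|w w' ww' _]; last first.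
  rewrite /G' (perm_size ww'); case: eqP => // wl; apply: Gp => //.
  by rewrite (perm_size ww').
rewrite mulr_suml big_seq_cond [RHS]big_seq_cond; apply: eq_bigr => w /andP[ww _].
rewrite -(GG _ ww) mulrAC mulrC; congr (_ * _).
have := ww; rewrite mem_words => /andP[/eqP <- _].
rewrite -multinomial natrM invfM mulrA divff ?mul1r // pnatr_eq0.
apply/eqP => p0; have := multinomial w; rewrite p0 mul0n => /esym/eqP.
by rewrite eqn0Ngt fact_gt0.
Qed.

End Words.

Section DformWords.
Context {R : realType} {d : nat} {T : eqType}.

Lemma dform_sum (E : seq T) (c : T -> R) (F : T -> 'rV[R]_d) l g y :
  dform (nseq l (\sum_(t <- E) c t *: F t)) g y =
  \sum_(w <- words E l) (\prod_(t <- w) c t) * dform (map F w) g y.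
Proof.
elim: l g => [|l IH] g /=; first by rewrite big_seq1 big_nil mul1r.
rewrite big_allpairs_dep /=.
transitivity (\sum_k \sum_(t <- E) \sum_(w <- words E l)
   (\prod_(x <- t :: w) c x) * (F t 0 k * dform (map F w) (pd k g) y)).
  apply: eq_bigr => k _; rewrite IH summxE mulr_suml; apply: eq_bigr => t _.
  rewrite mulr_sumr; apply: eq_bigr => w _.
  by rewrite mxE big_cons mulrACA.
rewrite exchange_big /=; apply: eq_bigr => t _.
rewrite exchange_big /=; apply: eq_bigr => w _.
by rewrite mulr_sumr.
Qed.

End DformWords.

(** * Trees and elementary differentials *)

Section Trees.
Context {N : nat}.

(** An enumeration of the trees of size at most [q], to replace sums over the
set [NTq N q] by sums over a list, to which words apply. *)
Definition trees q : seq (ptree N) := finmap.enum_fset (fset_set (NTq N q)).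

Lemma mem_trees q t : (t \in trees q) = Defs.canonical t && (tree_size t <= q)%N.
Proof.
rewrite in_fset_set; last exact: finite_NTq.
by apply/idP/andP; rewrite inE.
Qed.

Lemma trees_uniq q : uniq (trees q).
Proof. exact: finmap.fset_uniq. Qed.

Lemma tree_size_gt0 (t : ptree N) : (0 < tree_size t)%N.
Proof. by case: t. Qed.

Definition weight (w : seq (ptree N)) : nat := sumn (map (@tree_size N) w).

Lemma mem_weight w t : t \in w -> (tree_size t <= weight w)%N.
Proof.
rewrite /weight; elim: w => //= u w IH; rewrite inE => /orP[/eqP ->|/IH tw].
  exact: leq_addr.
exact: leq_trans tw (leq_addl _ _).
Qed.

Lemma size_weight w : (size w <= weight w)%N.
Proof.
rewrite /weight; elim: w => //= t w IH; rewrite -add1n leq_add //.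
exact: tree_size_gt0.
Qed.

(** Removing the root is a bijection from canonical trees with root [nu] and at
most [q.+1] nodes to sorted words of total size at most [q]. *)
Lemma sum_trees (R : nmodType) (K : ptree N -> R) (nu : 'I_N) q :
    (forall mu ts, mu != nu -> K (PNode mu ts) = 0) ->
  \sum_(t <- trees q.+1) K t =
  \sum_(l < q.+1) \sum_(w <- words (trees q) l |
      sorted (@ptree_le N) w && (weight w <= q)%N) K (PNode nu w).
Proof.
move=> K0; pose root (t : ptree N) := let: PNode mu _ := t in mu.
pose P w := sorted (@ptree_le N) w && (weight w <= q)%N.
pose L := [seq PNode nu w | l <- iota 0 q.+1,
                            w <- [seq w <- words (trees q) l | P w]].
have Kroot t : root t != nu -> K t = 0 by case: t => mu ts; exact: K0.
rewrite (bigID (fun t => root t == nu)) /= [X in _ + X]big1 ?addr0 //.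
rewrite -big_filter (perm_big L).
  rewrite big_allpairs_dep -[iota 0 q.+1]/(index_iota 0 q.+1) big_mkord.
  by apply: eq_bigr => l _; rewrite big_filter.
apply: uniq_perm; first by rewrite filter_uniq // trees_uniq.
  apply: allpairs_uniq_dep; first exact: iota_uniq.
    by move=> l _; rewrite filter_uniq // words_uniq // trees_uniq.
  move=> [l w] [l' w'] /allpairsPdep[a [b [_ + [-> ->]]]].
  rewrite mem_filter mem_words => /andP[_ /andP[/eqP <- _]].
  move=> /allpairsPdep[a' [b' [_ + [-> ->]]]].
  rewrite mem_filter mem_words => /andP[_ /andP[/eqP <- _]].
  by move=> [->].
move=> t; rewrite mem_filter mem_trees; apply/andP/allpairsPdep => [|[l [w]]].
  case: t => mu w /= [/eqP -> /andP[/andP[sw cw]]]; rewrite ltnS -/(weight w) => wq.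
  exists (size w), w; split=> //.
    by rewrite -[_ :: _]/(iota 0 q.+1) mem_iota ltnS (leq_trans (size_weight w)).
  rewrite mem_filter /P sw wq mem_words eqxx /=; apply/allP => t tw /=.
  by rewrite mem_trees (allP cw) // (leq_trans (mem_weight w t tw)).
move=> [_]; rewrite mem_filter mem_words => /andP[/andP[sw wq] /andP[_ cw]] -> /=.
rewrite eqxx sw ltnS -/(weight w) wq andbT; split=> //.
by apply/allP => u /(allP cw) /=; rewrite mem_trees => /andP[].
Qed.

(** The symmetries exchanging equal children of the root are counted by
[mult]; this is the factor that collecting rearranged words produces. *)
Lemma sigma_mult (R : comNzRingType) (c : 'I_N) ts :
  (sigma (PNode c ts))%:R = (mult ts)%:R * \prod_(t <- ts) (sigma t)%:R :> R.
Proof.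
rewrite sigmaE big_split natrM /=; congr (_ * _).
rewrite natr_prod -[RHS]prodr_undup_exp_count.
by apply: eq_bigr => t _; rewrite natrX.
Qed.

End Trees.

Section Bridge.
Context {R : realType} {d : nat}.
Implicit Types (f : 'rV[R]_d -> 'rV[R]_d) (g : 'rV[R]_d -> R).

Definition entry (k : 'I_d) f : 'rV[R]_d -> R := fun x => f x 0 k.

Lemma partial_entry i k f : (forall x, derivable f x (delta_mx 0 i)) ->
  pd i (entry k f) = entry k (partial i f).
Proof.
move=> fd; apply/funext => x; rewrite /pd /entry /partial.
by rewrite (derive_mx (fd x)) mxE.
Qed.

Lemma partials_entry m k f s : class_C m f -> (size s <= m)%N ->
  pds s (entry k f) = entry k (partials s f).
Proof.
move=> fC; elim: s => //= i s IH sm.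
rewrite IH ?(ltnW sm) //; apply: partial_entry => x.
by have [_] := fC s (ltnW sm); apply.
Qed.

Lemma class_C_smooth m k f : class_C m f -> smooth m (entry k f).
Proof.
move=> fC s sm; rewrite (partials_entry m) //; have [cf df] := fC s sm.
split=> [x|sm' i x].
  exact: (@continuous_comp _ _ _ (partials s f) (fun M => M 0 k) x (cf x)
            (@coord_continuous _ _ _ 0 k _)).
by have /derivable_mxP := df sm' i x; apply.
Qed.

Lemma smooth_pds m s g : smooth (size s + m) g -> smooth m (pds s g).
Proof.
move=> gs t tm; have := gs (t ++ s).
rewrite size_cat [X in (X <= _)%N]addnC leq_add2l [X in (X < _)%N]addnC ltn_add2l.
by rewrite /pds foldr_cat; apply.
Qed.

(** [dform] takes the derivative along its first argument innermost, while
[partials] takes it outermost; Schwarz's theorem reconciles the two. *)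
Lemma pd_pds k s g : smooth (size s).+1 g -> pd k (pds s g) = pds s (pd k g).
Proof.
elim: s => //= i s IH gs; rewrite -IH; last exact: smoothW gs.
by apply: schwarz; apply: smooth_pds; rewrite addn2.
Qed.

Lemma dform_partials (vs : seq 'rV[R]_d) g y : smooth (size vs) g ->
  dform vs g y = \sum_(i : (size vs).-tuple 'I_d)
    (\prod_(k < size vs) vs`_k 0 (tnth i k)) * pds i g y.
Proof.
elim: vs g => [|v vs IH] g gs /=.
  rewrite (big_pred1 [tuple]) => [|i]; last by apply/esym/eqP; exact: tuple0.
  by rewrite big_ord0 mul1r.
rewrite (reindex (fun p : 'I_d * (size vs).-tuple 'I_d => [tuple of p.1 :: p.2])) /=.
  rewrite -(pair_big xpredT xpredT (fun k (i : (size vs).-tuple 'I_d) =>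
     (\prod_(j < (size vs).+1) (v :: vs)`_j 0 (tnth [tuple of k :: i] j)) *
     pd k (pds i g) y)) /=.
  apply: eq_bigr => k _; rewrite (IH _ (smooth_pd _ _ _ gs)) mulr_sumr.
  apply: eq_bigr => i _; rewrite big_ord_recl /= tnth0 mulrA.
  rewrite pd_pds ?size_tuple //; congr (_ * _ * _).
  by apply: eq_bigr => j _; rewrite tnthS.
exists (fun t : (size vs).+1.-tuple 'I_d => (thead t, [tuple of behead t])).
  by move=> [k i] _ /=; congr (_, _); apply: val_inj.
by move=> t _; rewrite [RHS]tuple_eta.
Qed.

Lemma elemdiff_entry N (F : 'I_N -> 'rV[R]_d -> 'rV[R]_d) nu ts y k :
    class_C (size ts) (F nu) ->
  elemdiff F (PNode nu ts) y 0 k =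
  dform (map (fun t => elemdiff F t y) ts) (entry k (F nu)) y.
Proof.
move=> FC /=; set vs := map _ _; have sv : size vs = size ts by rewrite size_map.
rewrite dform_partials sv; last exact: class_C_smooth.
rewrite summxE; apply: eq_bigr => i _; rewrite mxE.
by rewrite (partials_entry (size ts)) // size_tuple.
Qed.

Lemma tree_series_entry N (F : 'I_N -> 'rV[R]_d -> 'rV[R]_d) p c y h k :
  tree_series F p c y h 0 k = \sum_(t <- trees p)
    h ^+ tree_size t / (sigma t)%:R * c t * elemdiff F t y 0 k.
Proof.
rewrite /tree_series fsbig_finite; last exact: finite_NTq.
by rewrite summxE; apply: eq_bigr => t _; rewrite mxE.
Qed.

End Bridge.

(** * Asymptotic orders at 0+ *)

Section Asymptotics.
Context {R : realType}.
Implicit Types phi psi : R -> R.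

(** The order is an explicit index, rather than a comparison function, so that
orders add up under products. *)
Definition isO (n : nat) phi : Prop :=
  exists C : R, \forall h \near 0^'+, `|phi h| <= C * h ^+ n.

Lemma isO_near n phi psi :
  (\forall h \near 0^'+, phi h = psi h) -> isO n psi -> isO n phi.
Proof.
move=> E [C HC]; exists C; near=> h.
have -> : phi h = psi h by near: h.
by near: h.
Unshelve. all: by end_near. Qed.

Lemma isO_eq n phi psi : (forall h, phi h = psi h) -> isO n psi -> isO n phi.
Proof. by move=> E; apply: isO_near; apply: nearW. Qed.

Lemma isO_le m n phi : (n <= m)%N -> isO m phi -> isO n phi.
Proof.
move=> nm [C HC]; exists `|C|; near=> h.
have h0 : 0 < h by near: h; exact: nbhs_right_gt.
have h1 : h <= 1 by near: h; exact: nbhs_right_le.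
have : `|phi h| <= C * h ^+ m by near: h.
move=> /le_trans; apply; apply: (@le_trans _ _ (`|C| * h ^+ m)).
  by rewrite ler_pM2r ?exprn_gt0 // ler_norm.
by rewrite ler_wpM2l // ler_wiXn2l // ltW.
Unshelve. all: by end_near. Qed.

Lemma isO_zero n : isO n (fun=> 0).
Proof. by exists 0; apply: nearW => h; rewrite normr0 mul0r. Qed.

Lemma isO_cst c : isO 0 (fun=> c).
Proof. by exists `|c|; apply: nearW => h; rewrite mulr1. Qed.

Lemma isO_expr n : isO n (fun h => h ^+ n).
Proof.
exists 1; near=> h.
have h0 : 0 < h by near: h; exact: nbhs_right_gt.
by rewrite mul1r ger0_norm // exprn_ge0 // ltW.
Unshelve. all: by end_near. Qed.

Lemma isO_add n phi psi :
  isO n phi -> isO n psi -> isO n (fun h => phi h + psi h).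
Proof.
move=> [C HC] [D HD]; exists (C + D); near=> h.
rewrite mulrDl (le_trans (ler_normD _ _)) // lerD //; by near: h.
Unshelve. all: by end_near. Qed.

Lemma isO_mul m n phi psi :
  isO m phi -> isO n psi -> isO (m + n) (fun h => phi h * psi h).
Proof.
move=> [C HC] [D HD]; exists (C * D); near=> h.
rewrite exprD mulrACA normrM ler_pM //; by near: h.
Unshelve. all: by end_near. Qed.

Lemma isO_mulc n phi c : isO n phi -> isO n (fun h => phi h * c).
Proof. by move=> pO; rewrite -[n]addn0; apply: isO_mul (isO_cst c). Qed.

Lemma isO_opp n phi : isO n phi -> isO n (fun h => - phi h).
Proof. by move=> [C HC]; exists C; apply: filterS HC => h; rewrite normrN. Qed.

Lemma isO_sum n (I : eqType) (r : seq I) (P : pred I) (F : I -> R -> R) :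
  (forall i, i \in r -> P i -> isO n (F i)) ->
  isO n (fun h => \sum_(i <- r | P i) F i h).
Proof.
elim: r => [|i r IH] HF.
  by apply: isO_eq (isO_zero n) => h; rewrite big_nil.
have {}IH : isO n (fun h => \sum_(i <- r | P i) F i h).
  by apply: IH => j jr; apply: HF; rewrite inE jr orbT.
case: (boolP (P i)) => Pi; last first.
  by apply: isO_eq IH => h; rewrite big_cons (negPf Pi).
have Hi : isO n (F i) by apply: HF; rewrite ?mem_head.
by apply: isO_eq (isO_add _ _ _ Hi IH) => h; rewrite big_cons Pi.
Qed.

Lemma isO_prod (I : eqType) (r : seq I) (n : I -> nat) (F : I -> R -> R) :
  (forall i, i \in r -> isO (n i) (F i)) ->
  isO (sumn (map n r)) (fun h => \prod_(i <- r) F i h).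
Proof.
elim: r => [|i r IH] HF /=.
  by apply: isO_eq (isO_cst 1) => h; rewrite big_nil.
have {}IH := IH (fun j jr => HF j (mem_behead (s := i :: r) jr)).
apply: isO_eq (isO_mul _ _ _ _ (HF i (mem_head _ _)) IH) => h.
by rewrite big_cons.
Qed.

Lemma isO_norm {d} n (v : R -> 'rV[R]_d) : (forall k, isO n (fun h => v h 0 k)) ->
  exists2 C : R, 0 <= C & \forall h \near 0^'+, `|v h| <= C * h ^+ n.
Proof.
move=> /choice[C HC]; exists (\sum_k `|C k|); first exact: sumr_ge0.
near=> h.
have h0 : 0 < h by near: h; exact: nbhs_right_gt.
have vC : forall k, `|v h 0 k| <= C k * h ^+ n.
  by near: h; apply: filter_forall => k; exact: HC.
apply: normv_le => [|k]; first by rewrite mulr_ge0 ?sumr_ge0 ?exprn_ge0 // ltW.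
apply: le_trans (vC k) _; rewrite ler_pM2r ?exprn_gt0 //.
rewrite (le_trans (ler_norm _)) // (bigD1 k) //= lerDl; exact: sumr_ge0.
Unshelve. all: by end_near. Qed.

End Asymptotics.

(** * Substituting a tree expansion into a Taylor polynomial *)

Section Expansion.
Context {R : realType} {d : nat}.
Implicit Types (g : 'rV[R]_d -> R) (v : R -> 'rV[R]_d).

Lemma dform_isO l g y v : (forall k, isO 0 (fun h => v h 0 k)) ->
  isO 0 (fun h => dform (nseq l (v h)) g y).
Proof.
move=> v0; elim: l g => [|l IH] g /=; first exact: isO_cst.
by apply: isO_sum => k _ _; apply: (isO_mul 0 0).
Qed.

(** The difference of two products of bounded factors, telescoped over the
factors. *)
Lemma dform_sub_isO n l g y v (w : R -> 'rV[R]_d) :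
    (forall k, isO 0 (fun h => v h 0 k)) -> (forall k, isO 0 (fun h => w h 0 k)) ->
    (forall k, isO n (fun h => v h 0 k - w h 0 k)) ->
  isO n (fun h => dform (nseq l (v h)) g y - dform (nseq l (w h)) g y).
Proof.
move=> v0 w0 vw; elim: l g => [|l IH] g /=.
  by apply: isO_eq (isO_zero n) => h; rewrite subrr.
pose D h k := (v h 0 k - w h 0 k) * dform (nseq l (v h)) (pd k g) y
  + w h 0 k * (dform (nseq l (v h)) (pd k g) y - dform (nseq l (w h)) (pd k g) y).
apply: (@isO_eq _ _ _ (fun h => \sum_k D h k)) => [h|].
  by rewrite -sumrB; apply: eq_bigr => k _; rewrite /D mulrBl mulrBr addrA subrK.
apply: isO_sum => k _ _; apply: isO_add.
  by rewrite -[n]addn0; apply: isO_mul => //; exact: dform_isO.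
by rewrite -[n]add0n; exact: isO_mul.
Qed.

Lemma taylor_isO q g y v : smooth q g -> (forall k, isO 1 (fun h => v h 0 k)) ->
  isO q (fun h => g (y + v h) - taylor q g y (v h)).
Proof.
move=> gs v1; have [C [r [C0 r0 gC]]] := taylor_bound q g y gs.
have [D D0 vD] := isO_norm 1 v v1.
exists (C * D ^+ q); near=> h.
have vh : `|v h| <= D * h by near: h; apply: filterS vD => h; rewrite expr1.
have h0 : 0 < h by near: h; exact: nbhs_right_gt.
have hr : D * h < r.
  have Dr : D * h <= (D + 1) * h by rewrite ler_pM2r // lerDl.
  apply: le_lt_trans Dr _; rewrite mulrC -ltr_pdivlMr ?ltr_pwDr //.
  by near: h; apply: nbhs_right_lt; rewrite divr_gt0 ?ltr_pwDr.
apply: le_trans (gC _ (le_lt_trans vh hr)) _.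
rewrite -mulrA -exprMn ler_wpM2l // lerXn2r ?nnegrE //.
by rewrite mulr_ge0 // ltW.
Unshelve. all: by end_near. Qed.

(** Three errors of order [q.+1] are made: Taylor's remainder, the replacement
of [v] by the tree sum [S] in the Taylor polynomial, and the omission of the
words of weight above [q]. *)
Lemma expansion N q g y v (c : ptree N -> R -> R) (F : ptree N -> 'rV[R]_d) :
    smooth q.+1 g ->
    (forall t, isO (tree_size t) (c t)) ->
    (forall k, isO q.+1 (fun h => (v h - \sum_(t <- trees q) c t h *: F t) 0 k)) ->
  isO q.+1 (fun h => g (y + v h) -
    \sum_(l < q.+1) \sum_(w <- words (trees q) l |
        sorted (@ptree_le N) w && (weight w <= q)%N)
      (\prod_(t <- w) c t h) / (mult w)%:R * dform (map F w) g y).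
Proof.
move=> gs cO vr.
pose S h := \sum_(t <- trees q) c t h *: F t.
have S1 k : isO 1 (fun h => S h 0 k).
  apply: (@isO_eq _ _ _ (fun h => \sum_(t <- trees q) c t h * F t 0 k)) => [h|].
    by rewrite summxE; apply: eq_bigr => t _; rewrite mxE.
  apply: isO_sum => t _ _; apply: (isO_le (tree_size t) 1 _ (tree_size_gt0 t)).
  exact: isO_mulc.
have r1 k : isO 1 (fun h => (v h - S h) 0 k) by exact: (isO_le q.+1).
have v1 k : isO 1 (fun h => v h 0 k).
  apply: isO_eq (isO_add _ _ _ (r1 k) (S1 k)) => h.
  by rewrite !mxE subrK.
pose W h l (Q : pred (seq (ptree N))) :=
  \sum_(w <- words (trees q) l | sorted (@ptree_le N) w && Q w)
   (\prod_(t <- w) c t h) / (mult w)%:R * dform (map F w) g y.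
(* The Taylor polynomial at S, regrouped over sorted words. *)
have TS h : taylor q.+1 g y (S h) = \sum_(l < q.+1) W h l xpredT.
  rewrite /taylor; apply: eq_bigr => l _; rewrite dform_sum.
  rewrite (sum_words_div _ (@ptree_le N)) ?trees_uniq //.
  - rewrite /W; apply: eq_big => [w|w _]; first by rewrite andbT.
    by rewrite mulrAC.
  - exact: ptree_le_total.
  - exact: ptree_le_trans.
  - exact: ptree_le_anti.
  move=> w w' ww' wl; congr (_ * _); first exact: perm_big.
  apply: dform_perm (perm_map F ww'); rewrite size_map wl.
  by apply: smoothW gs; rewrite ltnW.
have Wsplit h l : W h l xpredT = W h l (fun w => weight w <= q)%N +
     W h l (fun w => ~~ (weight w <= q))%N.
  rewrite /W (bigID (fun w => weight w <= q)%N) /=.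
  by congr (_ + _); apply: eq_bigl => w; rewrite andbT.
have large l : isO q.+1 (fun h => W h l (fun w => ~~ (weight w <= q))%N).
  apply: isO_sum => w _ /andP[_]; rewrite -ltnNge => qw.
  apply: (isO_le (weight w)) => //.
  do 2!apply: isO_mulc; exact: isO_prod.
have T := taylor_isO q.+1 g y v gs v1.
have vS : isO q.+1 (fun h => taylor q.+1 g y (v h) - taylor q.+1 g y (S h)).
  apply: (@isO_eq _ _ _ (fun h => \sum_(l < q.+1)
     (dform (nseq l (v h)) g y - dform (nseq l (S h)) g y) / (l`!)%:R)) => [h|].
    by rewrite /taylor -sumrB; apply: eq_bigr => l _; rewrite mulrBl.
  apply: isO_sum => l _ _; apply: isO_mulc.
  apply: dform_sub_isO => k; [exact: (isO_le 1)|exact: (isO_le 1)|].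
  by apply: isO_eq (vr k) => h; rewrite !mxE.
have L : isO q.+1 (fun h => \sum_(l < q.+1) W h l (fun w => ~~ (weight w <= q))%N).
  by apply: isO_sum => l _ _; exact: large.
apply: isO_eq (isO_add _ _ _ T (isO_add _ _ _ vS L)) => h.
have E : taylor q.+1 g y (S h) = \sum_(l < q.+1) W h l (fun w => weight w <= q)%N
     + \sum_(l < q.+1) W h l (fun w => ~~ (weight w <= q))%N.
  by rewrite TS -big_split; apply: eq_bigr => l _; exact: Wsplit.
rewrite E -[X in _ - X]/(\sum_(l < q.+1) W h l (fun w => weight w <= q)%N).
by rewrite addrA subrKA opprD addrA subrK.
Qed.

End Expansion.

(** * The expansion of the stages *)

Section StageExpansion.
Context {R : realType} {d N s : nat}.
Implicit Types (f : 'I_N -> 'rV[R]_d -> 'rV[R]_d) (A : R -> 'I_N -> 'M[R]_s).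
Implicit Types (y : 'rV[R]_d) (Y : R -> 'I_s -> 'rV[R]_d).

(** The induction hypothesis of the bootstrap.  It bears on the stage derivatives
because both the stages and the output are linear in them. *)
Definition deriv_expansion f A y Y q : Prop := forall i nu k,
  isO q.+1 (fun h =>
    (h *: f nu (Y h i) - tree_series f q (fun t => gcoef (A h) t i nu) y h) 0 k).

Lemma dcoef_isO A t i : (forall nu i j, isO 0 (fun h => A h nu i j)) ->
  isO 0 (fun h => dcoef (A h) t i).
Proof.
move=> A0; elim/ptree_ind': t i => mu ts IH i.
have {}IH t : t \in ts -> forall i, isO 0 (fun h => dcoef (A h) t i).
  elim: IH => //= u us su _ IHu; rewrite inE => /orP[/eqP ->|/IHu] //.
apply: isO_sum => nu _ _; apply: isO_sum => j _ _; apply: (isO_mul 0 0) => //.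
apply: (@isO_eq _ _ _ (fun h => (nu == mu)%:R * \prod_(t <- ts) dcoef (A h) t j)).
  by move=> h; rewrite gcoefE.
apply: (isO_mul 0 0); first exact: isO_cst.
have := @isO_prod R _ ts (fun=> 0%N) (fun t h => dcoef (A h) t j).
have -> : sumn [seq 0%N | _ <- ts] = 0%N by elim: (ts).
by apply=> t tts; exact: IH.
Qed.

(** The defining relation of [dcoef] and [ucoef] in terms of [gcoef] is the one
between the stages, or the output, and the stage derivatives; the factors
[al] stand for a row of the stage coefficients or for the output weights. *)
Lemma combine_stages f A y Y q (al : 'I_N -> 'I_s -> R -> R) k :
    deriv_expansion f A y Y q -> (forall nu j, isO 0 (al nu j)) ->
  isO q.+1 (fun h => (h *: (\sum_j \sum_nu al nu j h *: f nu (Y h j)) -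
    tree_series f q (fun t => \sum_nu \sum_j al nu j h * gcoef (A h) t j nu) y h) 0 k).
Proof.
move=> D al0.
apply: (@isO_eq _ _ _ (fun h => \sum_j \sum_nu al nu j h *
  (h *: f nu (Y h j) - tree_series f q (fun t => gcoef (A h) t j nu) y h) 0 k)).
  move=> h; rewrite !mxE tree_series_entry summxE mulr_sumr.
  under [RHS]eq_bigr => j _ do
    (under eq_bigr => nu _ do rewrite !mxE mulrBr tree_series_entry; rewrite sumrB).
  rewrite sumrB; congr (_ - _).
    apply: eq_bigr => j _; rewrite summxE mulr_sumr; apply: eq_bigr => nu _.
    by rewrite mxE mulrCA.
  under [RHS]eq_bigr => j _ do
    (under eq_bigr => nu _ do rewrite mulr_sumr; rewrite exchange_big /=).
  rewrite exchange_big /=; apply: eq_bigr => t _.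
  rewrite [in LHS]exchange_big /= mulr_sumr mulr_suml; apply: eq_bigr => j _.
  rewrite mulr_sumr mulr_suml; apply: eq_bigr => nu _.
  by rewrite (mulrCA _ (al nu j h)) -!mulrA.
apply: isO_sum => j _ _; apply: isO_sum => nu _ _.
exact: (isO_mul 0).
Qed.

Lemma near_mul_le (E : R) : 0 <= E -> \forall h \near 0^'+, h * E <= 1 / 2.
Proof.
move=> E0; near=> h.
have h0 : 0 < h by near: h; exact: nbhs_right_gt.
have hE : h <= (1 / 2) / (E + 1).
  by near: h; apply: nbhs_right_le; rewrite !divr_gt0 // ltr_wpDl.
move: hE; rewrite ler_pdivlMr ?ltr_wpDl //; apply: le_trans.
by rewrite ler_pM2l // lerDl.
Unshelve. all: by end_near. Qed.

(** The sum [D] of the norms of the displacements satisfies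
[D <= h * c * (M + K * D)] where [M] bounds the norms of the [f nu y] and [K]
the Lipschitz constants; for small [h] both [h * c * M] and [h * c * K] are at most 1/2,
whence [D <= 1]. *)
Lemma stages_bounded f A y Y : (forall nu, lipschitz (f nu)) ->
    (forall nu i j, isO 0 (fun h => A h nu i j)) ->
    (\forall h \near 0^'+, nsark_stages f (A h) y h (Y h)) ->
  \forall h \near 0^'+, forall i, `|Y h i - y| <= 1.
Proof.
move=> flip A0 st.
have /choice[L HL] nu : exists L : R,
    0 <= L /\ forall x z, `|f nu x - f nu z| <= L * `|x - z|.
  have [L [L0 HL]] := pinfty_ex_gt0 (flip nu).
  by exists L; split; [exact: ltW|move=> x z; exact: (HL (x, z))].
have /choice[a Ha] (x : 'I_N * 'I_s * 'I_s) : exists C : R, \forall h \near 0^'+,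
    `|A h x.1.1 x.1.2 x.2| <= C.
  have [C HC] := A0 x.1.1 x.1.2 x.2; exists C.
  by apply: filterS HC => h; rewrite mulr1.
pose B := \sum_x `|a x|.
pose M := \sum_nu `|f nu y|.
pose K := \sum_nu L nu.
have B0 : 0 <= B by exact: sumr_ge0.
have M0 : 0 <= M by exact: sumr_ge0.
have K0 : 0 <= K by apply: sumr_ge0 => nu _; case: (HL nu).
pose c := B *+ N *+ s *+ s.
have c0 : 0 <= c by rewrite !mulrn_wge0.
near=> h.
have h0 : 0 < h by near: h; exact: nbhs_right_gt.
have hK : h * (c * K) <= 1 / 2.
  by near: h; apply: near_mul_le; rewrite mulr_ge0.
have hM : h * (c * M) <= 1 / 2.
  by near: h; apply: near_mul_le; rewrite mulr_ge0.
have Ah nu i j : `|A h nu i j| <= B.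
  have ha : forall x, `|A h x.1.1 x.1.2 x.2| <= a x.
    by near: h; apply: filter_forall => x; exact: Ha.
  apply: le_trans (ha (nu, i, j)) _; rewrite /B (bigD1 (nu, i, j)) //=.
  rewrite (le_trans (ler_norm _)) // lerDl; exact: sumr_ge0.
have Yh : nsark_stages f (A h) y h (Y h) by near: h.
pose D := \sum_i `|Y h i - y|.
have D0 : 0 <= D by exact: sumr_ge0.
have YD i : `|Y h i - y| <= D.
  by rewrite /D (bigD1 i) //= lerDl; exact: sumr_ge0.
have fD nu j : `|f nu (Y h j)| <= M + K * D.
  rewrite -[f nu _](subrK (f nu y)) addrC (le_trans (ler_normD _ _)) // lerD //.
    by rewrite /M (bigD1 nu) //= lerDl; exact: sumr_ge0.
  have [L0 fL] := HL nu; apply: le_trans (fL _ _) _; rewrite ler_pM //.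
  by rewrite /K (bigD1 nu) //= lerDl; apply: sumr_ge0 => mu _; case: (HL mu).
have Dle : D <= h * (c * (M + K * D)).
  have -> : h * (c * (M + K * D)) =
      \sum_(i < s) h * \sum_(j < s) \sum_(nu < N) B * (M + K * D).
    by rewrite !(sumr_const, card_ord) /c !mulrnAl !mulrnAr.
  apply: ler_sum => i _; rewrite (Yh i) addrC addKr normrZ gtr0_norm // ler_pM2l //.
  apply: le_trans (ler_norm_sum _ _ _) _; apply: ler_sum => j _.
  apply: le_trans (ler_norm_sum _ _ _) _; apply: ler_sum => nu _.
  by rewrite normrZ ler_pM.
have D1 : D <= 1.
  have : D <= 1 / 2 + 1 / 2 * D.
    apply: le_trans Dle _; rewrite mulrDr mulrDr lerD //.
    by rewrite (mulrA c) (mulrA h) ler_wpM2r.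
  lra.
by move=> i; exact: le_trans (YD i) D1.
Unshelve. all: by end_near. Qed.

Lemma deriv_expansion0 f A y Y : (forall nu, lipschitz (f nu)) ->
    (forall nu i j, isO 0 (fun h => A h nu i j)) ->
    (\forall h \near 0^'+, nsark_stages f (A h) y h (Y h)) ->
  deriv_expansion f A y Y 0.
Proof.
move=> flip A0 st i nu k; have Yb := stages_bounded f A y Y flip A0 st.
have [L [L0 HL]] := pinfty_ex_gt0 (flip nu).
exists (`|f nu y| + L); near=> h.
have h0 : 0 < h by near: h; exact: nbhs_right_gt.
have Yh : forall i, `|Y h i - y| <= 1 by near: h.
have fL : `|f nu (Y h i) - f nu y| <= L * `|Y h i - y| by exact: (HL (Y h i, y)).
rewrite !mxE tree_series_entry big1_seq ?subr0 => [|t /andP[_]]; last first.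
  by rewrite mem_trees leqNgt tree_size_gt0 andbF.
rewrite expr1 normrM (gtr0_norm h0) mulrC ler_pM2r //.
apply: le_trans (normv_ge _ k) _.
rewrite -[f nu _](subrK (f nu y)) addrC (le_trans (ler_normD _ _)) // lerD2l.
apply: le_trans fL _; by rewrite ler_piMr // ltW.
Unshelve. all: by end_near. Qed.

Lemma class_CW m n (F : 'rV[R]_d -> 'rV[R]_d) :
  (m <= n)%N -> class_C n F -> class_C m F.
Proof.
move=> mn FC u um; have [cu du] := FC u (leq_trans um mn).
by split=> // um'; apply/du/(leq_trans um').
Qed.

(** The stages are expanded to order [q] by [combine_stages], and the right-hand
sides along them by [expansion]; the factor [h] raises the order to [q.+1] and
accounts for the root of the trees so obtained. *)
Lemma deriv_expansionS f A y Y q :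
    (forall nu, class_C q.+1 (f nu)) ->
    (forall nu i j, isO 0 (fun h => A h nu i j)) ->
    (\forall h \near 0^'+, nsark_stages f (A h) y h (Y h)) ->
  deriv_expansion f A y Y q -> deriv_expansion f A y Y q.+1.
Proof.
move=> fC A0 st D i nu k.
pose c t h : R := h ^+ tree_size t / (sigma t)%:R * dcoef (A h) t i.
have cO t : isO (tree_size t) (c t).
  rewrite -[tree_size t]addn0; apply: isO_mul (dcoef_isO _ _ _ A0).
  exact/isO_mulc/isO_expr.
have stage : forall k, isO q.+1
    (fun h => (Y h i - y - \sum_(t <- trees q) c t h *: elemdiff f t y) 0 k).
  move=> l; have := combine_stages f A y Y q (fun nu j h => A h nu i j) l D
    (fun nu j => A0 nu i j).
  apply: isO_near; near=> h.
  have Yh : nsark_stages f (A h) y h (Y h) by near: h.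
  rewrite {1}(Yh i) [_ + _ - y]addrC addKr !mxE; congr (_ - _).
  rewrite tree_series_entry summxE; apply: eq_bigr => t _.
  by rewrite mxE.
have E := expansion N q _ y (fun h => Y h i - y) c (fun t => elemdiff f t y)
  (class_C_smooth _ k _ (fC nu)) cO stage.
have := isO_mul 1 q.+1 _ _ (isO_expr 1) E; rewrite add1n.
apply: isO_eq => h; rewrite expr1 !mxE mulrBr; congr (_ - _).
  by rewrite /entry addrC subrK.
rewrite tree_series_entry (sum_trees _ _ nu) => [|mu ts munu]; last first.
  by rewrite gcoefE eq_sym (negPf munu) mul0r mulr0 mul0r.
rewrite mulr_sumr; apply: eq_bigr => l _.
rewrite mulr_sumr big_seq_cond [RHS]big_seq_cond.
apply: eq_bigr => w /andP[+ /andP[_ wq]].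
rewrite mem_words => /andP[/eqP wl _].
rewrite elemdiff_entry; last first.
  by apply: class_CW (fC nu); rewrite wl ltnW.
rewrite gcoefE eqxx mul1r sigma_mult mulrA; congr (_ * _).
have -> : \prod_(t <- w) c t h =
    h ^+ weight w / (\prod_(t <- w) (sigma t)%:R) * \prod_(t <- w) dcoef (A h) t i.
  by rewrite /c !big_split /= prodfV /weight sumnE big_map -expr_sum.
rewrite [tree_size _]/= -/(weight w) exprS invfM; ring.
Unshelve. all: by end_near. Qed.

End StageExpansion.

Lemma isO_eqaddO {R : realType} {d : nat} n (F G : R -> 'rV[R]_d) :
  (forall k, isO n (fun h => (F h - G h) 0 k)) ->
  F = G +O_ (0^'+) (fun h => h ^+ n : R^o).
Proof.
move=> /isO_norm[C C0 HC]; apply/eqaddOP/bigO_exP.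
exists (C + 1); first by rewrite ltr_wpDl.
near=> h.
have h0 : 0 < h by near: h; exact: nbhs_right_gt.
have FG : `|F h - G h| <= C * h ^+ n by near: h.
apply: le_trans FG _; rewrite ger0_norm ?exprn_ge0 ?(ltW h0) //.
by rewrite ler_pM2r ?exprn_gt0 // lerDl.
Unshelve. all: by end_near. Qed.

Lemma bigO1_isO {R : realType} (phi : R -> R) :
  (phi : R -> R^o) =O_ (0^'+) (fun=> 1 : R^o) -> isO 0 phi.
Proof.
move=> /eqO_exP[C C0 HC]; exists C; apply: filterS HC => h /=.
by rewrite normr1.
Qed.

Theorem theorem4p1 (R : realType) (d N s p : nat)
    (f : 'I_N -> 'rV[R]_d -> 'rV[R]_d)
    (a : 'rV[R]_d -> R -> 'I_N -> 'M[R]_s)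
    (b : 'rV[R]_d -> R -> 'I_N -> 'rV[R]_s)
    (yn : 'rV[R]_d) (Y : R -> 'I_s -> 'rV[R]_d)
    (f_C : forall nu, class_C p.+1 (f nu))
    (f_lip : forall nu, lipschitz (f nu))
    (stages : \forall h \near 0^'+, nsark_stages f (a yn h) yn h (Y h))
    (a_O1 : forall i j nu,
       (fun h => a yn h nu i j : R^o) =O_ (0^'+) (fun=> 1 : R^o)) :
  [/\ forall i,
        (fun h => Y h i) =
        (fun h => yn + tree_series f p (fun t => dcoef (a yn h) t i) yn h)
        +O_ (0^'+) (fun h => h ^+ p.+1 : R^o),
      forall i nu,
        (fun h => h *: f nu (Y h i)) =
        (fun h => tree_series f p (fun t => gcoef (a yn h) t i nu) yn h)
        +O_ (0^'+) (fun h => h ^+ p.+1 : R^o)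
    & (forall j nu,
         (fun h => b yn h nu 0 j : R^o) =O_ (0^'+) (fun=> 1 : R^o)) ->
        (fun h => nsark_output f (b yn h) yn h (Y h)) =
        (fun h => yn + tree_series f p (ucoef (a yn h) (b yn h)) yn h)
        +O_ (0^'+) (fun h => h ^+ p.+1 : R^o)].
Proof.
have A0 nu i j : isO 0 (fun h => a yn h nu i j) by exact: bigO1_isO.
have D : deriv_expansion f (a yn) yn Y p.
  elim: p f_C => [|q IH] fC; first exact: deriv_expansion0.
  have fC' nu : class_C q.+1 (f nu) by apply: class_CW (fC nu).
  by apply: deriv_expansionS (IH fC').
split.
- move=> i; apply: isO_eqaddO => k.
  have := combine_stages f _ yn Y p (fun nu j h => a yn h nu i j) k D
    (fun nu j => A0 nu i j).
  apply: isO_near; near=> h.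
  have Yh : nsark_stages f (a yn h) yn h (Y h) by near: h.
  by rewrite {1}(Yh i) opprD addrA [yn + _ - yn]addrC addKr.
- by move=> i nu; apply: isO_eqaddO => k; exact: D.
move=> b_O1; apply: isO_eqaddO => k.
have := combine_stages f _ yn Y p (fun nu j h => b yn h nu 0 j) k D
  (fun nu j => bigO1_isO _ (b_O1 j nu)).
by apply: isO_eq => h; rewrite /nsark_output opprD addrA [yn + _ - yn]addrC addKr.
Unshelve. all: by end_near. Qed.
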